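(* Let $S=k[x_1,\ldots,x_n]$ be the polynomial ring over a field $k$ and let $I$ be a constructible ideal of $S$ generated in degree $q$. Then $I$ has a $q$-linear resolution.
   Context: A monomial ideal of $S$ generated in a single degree $q$ is a constructible ideal if it can be obtained by the following recursive procedure: (i) if $u$ is a monomial of $S$ and $I=(u)$, then $I$ is constructible; (ii) if $I_1,I_2$ are constructible ideals generated in degree $q$ and $I_1\cap I_2$ is a constructible ideal generated in degree $q+1$, then $I_1+I_2$ is a constructible ideal. An ideal $I$ has a $q$-linear resolution if $\mathrm{Tor}^S_i(I,k)_{i+j}=0$ for all $i$ and all $j\ne q$. *)

(* Defs.v *)
From HB Require Import structures.
From mathcomp Require Import all_boot all_order all_algebra.
From mathcomp Require Import mpoly.

Set Implicit Arguments.
Unset Strict Implicit.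
Unset Printing Implicit Defensive.

Import GRing.Theory.
Local Open Scope ring_scope.

Section Ideals.

Variables (k : fieldType) (n : nat).
Local Notation S := {mpoly k[n]}.

Definition subset_of_ring := S -> Prop.

Definition same_set (I J : subset_of_ring) : Prop := forall f, I f <-> J f.

Definition principal_ideal (u : S) : subset_of_ring :=
  fun f => exists g : S, f = g * u.

Definition ideal_cap (I J : subset_of_ring) : subset_of_ring :=
  fun f => I f /\ J f.

Definition ideal_add (I J : subset_of_ring) : subset_of_ring :=
  fun f => exists g h : S, [/\ I g, J h & f = g + h].

(* [constructible q I]: I is a constructible ideal generated in degree q.     *)
(* Subsets of S are Prop-valued predicates, so both clauses are closed under  *)
(* extensional equality by way of [same_set].                                 *)
Inductive constructible : nat -> subset_of_ring -> Prop :=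
| constructible_principal (m : 'X_{1..n}) (I : subset_of_ring) :
    same_set I (principal_ideal 'X_[m]) -> constructible (mdeg m) I
| constructible_add (q : nat) (I1 I2 I : subset_of_ring) :
    constructible q I1 -> constructible q I2 ->
    constructible q.+1 (ideal_cap I1 I2) ->
    same_set I (ideal_add I1 I2) -> constructible q I.

(* Homogeneity in a possibly negative degree: 0 is the only homogeneous       *)
(* element of negative degree (and 0 is m.-homog for every m).                *)
Definition homog_int (e : int) (p : S) : bool :=
  if e is Posz m then p \is m.-homog else p == 0.

(* A graded free resolution                                                   *)
(*     ... -> F_2 --gr_diff 1--> F_1 --gr_diff 0--> F_0 --gr_aug--> I -> 0    *)
(* by free modules of finite rank. F_i is 'rV[S]_(gr_rank i); its a-th basis  *)
(* vector has degree gr_deg i a. Maps act on row vectors by right             *)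
(* multiplication and preserve degrees. gr_aug is the augmentation followed   *)
(* by the inclusion of I into S.                                              *)
Record graded_resolution (I : subset_of_ring) := GradedResolution {
  gr_rank : nat -> nat;
  gr_deg : forall i, 'I_(gr_rank i) -> int;
  gr_aug : 'cV[S]_(gr_rank 0);
  gr_diff : forall i, 'M[S]_(gr_rank i.+1, gr_rank i);
  gr_aug_homog : forall a, homog_int (gr_deg a) (gr_aug a 0);
  gr_diff_homog : forall i (a : 'I_(gr_rank i.+1)) (b : 'I_(gr_rank i)),
    homog_int (gr_deg a - gr_deg b) (gr_diff i a b);
  gr_aug_image : forall f : S,
    I f <-> exists u : 'rV[S]_(gr_rank 0), f = (u *m gr_aug) 0 0;
  gr_exact0 : forall u : 'rV[S]_(gr_rank 0),
    u *m gr_aug = 0 <-> exists v : 'rV[S]_(gr_rank 1), u = v *m gr_diff 0;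
  gr_exactS : forall i (u : 'rV[S]_(gr_rank i.+1)),
    u *m gr_diff i = 0 <->
    exists v : 'rV[S]_(gr_rank i.+2), u = v *m gr_diff i.+1
}.

Section Tor.

Variables (I : subset_of_ring) (F : graded_resolution I).

(* The differential of F (x)_S k, where k = S / (x_1, ..., x_n): F_i (x) k is *)
(* 'rV[k]_(gr_rank F i), and S -> k takes the constant coefficient.           *)
Definition tensor_diff i : 'M[k]_(gr_rank F i.+1, gr_rank F i) :=
  map_mx (fun p : S => p@_0%MM) (gr_diff F i).

Definition degree_part i (d : int) : 'M[k]_(gr_rank F i) :=
  diag_mx (\row_a (gr_deg a == d)%:R).

Definition cycles i : 'M[k]_(gr_rank F i) :=
  match i return 'M[k]_(gr_rank F i) with
  | 0 => 1%:M
  | j.+1 => kermx (tensor_diff j)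
  end.

(* Tor^S_i(I, k)_d computed from F, i.e. the degree d part of H_i(F (x) k).   *)
(* The quotient of the space of cycles by the space of boundaries is          *)
(* represented by a complement of the latter in the former.                   *)
Definition Tor i (d : int) : 'M[k]_(gr_rank F i) :=
  ((cycles i :&: degree_part i d) :\: (tensor_diff i :&: degree_part i d))%MS.

End Tor.

(* Tor^S(I, k) does not depend on the graded free resolution computing it;    *)
(* vanishing is required for all of them, and the first conjunct rules out    *)
(* that this holds vacuously. The index j ranges over int since i + j may be  *)
(* a nonnegative degree for negative j.                                       *)
Definition has_linear_resolution (q : nat) (I : subset_of_ring) : Prop :=
  inhabited (graded_resolution I) /\
  forall (F : graded_resolution I) (i : nat) (j : int),
    j != q%:Z -> Tor F i (i%:Z + j) = 0.

End Ideals.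

(* Main.v *)
(* If F1, F2 are resolutions of I1, I2 whose i-th module is generated in degree
   q + i, and G is one of the intersection of I1 and I2 with generators in
   degree q + 1 + i, then the mapping cone of the map G -> F1 (+) F2 lifting
   f |-> (f, -f) resolves I1 + I2, and its i-th module, the sum of G_(i-1), F1_i
   and F2_i, is again generated in degree q + i. So every constructible ideal
   has a resolution L of this kind. Any graded resolution F of the ideal maps
   to L and back by degree-preserving maps whose composite is homotopic to the
   identity; modulo the variables the map F_i -> L_i vanishes in degrees other
   than q + i, so there every cycle is a boundary. *)
From HB Require Import structures.
From Stdlib Require Import IndefiniteDescription.
From mathcomp Require Import all_boot all_order all_algebra.
From mathcomp Require Import mpoly zify ring.
Require Import Defs.

Set Implicit Arguments.
Unset Strict Implicit.
Unset Printing Implicit Defensive.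

Import GRing.Theory.
Local Open Scope ring_scope.

(** Chain maps and homotopies are built one degree at a time: the invariant [Q] keeps the next step
    solvable, and [R] ties consecutive choices together. *)
Lemma dependent_choice_nat (A : nat -> Type) (Q : forall i, A i -> Prop)
    (R : forall i, A i -> A i.+1 -> Prop) (a0 : A 0) :
  Q 0 a0 ->
  (forall i a, Q i a -> exists b, Q i.+1 b /\ R i a b) ->
  exists f : forall i, A i,
    [/\ f 0 = a0, forall i, Q i (f i) & forall i, R i (f i) (f i.+1)].
Proof.
move=> Q0 step.
pose nxt i (a : {a | Q i a}) : {b | Q i.+1 b /\ R i (sval a) b} :=
  constructive_indefinite_description _ (step i (sval a) (svalP a)).
pose g := nat_rect (fun i => {a | Q i a}) (exist _ a0 Q0)
  (fun i a => exist _ (sval (nxt i a)) (proj1 (svalP (nxt i a)))).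
exists (fun i => sval (g i)); split=> // i; first exact: (svalP (g i)).
exact: (proj2 (svalP (nxt i (g i)))).
Qed.

(** * Homogeneous polynomials and matrices, with degrees in the integers *)

Section Homogeneous.

Variables (k : fieldType) (n : nat).
Local Notation S := {mpoly k[n]}.
Implicit Types (e d : int) (p : S).

Lemma homog_intP e p :
  reflect (forall m, m \in msupp p -> (mdeg m)%:Z = e) (homog_int e p).
Proof.
case: e => d /=.
  by apply: (iffP (dhomogP _ _ _)) => h m /h; [move=> -> | case].
apply: (iffP eqP) => [-> m|h]; first by rewrite msupp0.
apply/eqP; rewrite -msupp_eq0; case: (msupp p) h => // m s /(_ m).
by rewrite mem_head => /(_ isT).
Qed.

Lemma homog_int0 e : homog_int e (0 : S).
Proof. by apply/homog_intP => m; rewrite msupp0. Qed.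

Lemma homog_intN e p : homog_int e (- p) = homog_int e p.
Proof. by case: e => d /=; rewrite ?oppr_eq0 ?rpredN. Qed.

Lemma homog_intM d e p q :
  homog_int d p -> homog_int e q -> homog_int (d + e) (p * q).
Proof.
move=> /homog_intP hp /homog_intP hq; apply/homog_intP => m /msuppM_le.
by case/allpairsP => -[a b] /= [/hp <- /hq <- ->]; rewrite mdegD.
Qed.

Lemma homog_int_sum (I : finType) (P : pred I) (F : I -> S) e :
  (forall i, P i -> homog_int e (F i)) -> homog_int e (\sum_(i | P i) F i).
Proof.
case: e => d hF; first exact: rpred_sum.
by rewrite /= big1 // => i /hF /eqP.
Qed.

Lemma homog_int_mcoeff0 e p : homog_int e p -> e != 0 -> p@_0%MM = 0.
Proof.
move=> /homog_intP hp e0; apply/memN_msupp_eq0/negP => /hp; rewrite mdeg0.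
by move=> he; rewrite -he in e0.
Qed.

Definition homog_part e p : S :=
  if e is Posz d then pihomog mdeg d p else 0.

Fact homog_part_is_linear e : linear (homog_part e).
Proof.
by case: e => d c p q /=; [rewrite linearP | rewrite scaler0 addr0].
Qed.

HB.instance Definition _ e :=
  GRing.isLinear.Build k S S _ (homog_part e) (homog_part_is_linear e).

Lemma homog_part_homog e p : homog_int e (homog_part e p).
Proof. by case: e => d /=; [exact: pihomogP | exact: eqxx]. Qed.

Lemma homog_part_dE d e p :
  homog_int d p -> homog_part e p = if d == e then p else 0.
Proof.
case: d e => [d|d] [e|e] //= hp.
- rewrite eqz_nat; case: eqP => [<-|/eqP ne]; first exact: pihomog_dE.
  by apply: pihomog_ne0 hp; apply: contra ne => /eqP ->.
- by rewrite (eqP hp) linear0.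
- by rewrite (eqP hp); case: ifP.
Qed.

(** By linearity [p] may be taken to be a monomial; then [p * q] is homogeneous, and both sides are
    [p * q] or 0 according to its degree. *)
Lemma homog_partM d e p q :
  homog_int d q -> homog_part e (p * q) = homog_part (e - d) p * q.
Proof.
move=> hq; rewrite [p]mpolyE mulr_suml !linear_sum mulr_suml.
apply: eq_bigr => m _; rewrite -scalerAl !linearZ /= -scalerAl; congr (_ *: _).
have hX : homog_int (mdeg m)%:Z ('X_[m] : S) by rewrite /= dhomogX.
rewrite (homog_part_dE _ hX) (homog_part_dE _ (homog_intM hX hq)).
by rewrite -[in LHS](subrK d e) (inj_eq (addIr d)); case: ifP; rewrite ?mul0r.
Qed.

(** Matrices of degree-preserving maps between graded free modules with basis degrees [dr] and
    [ds]. *)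
Definition homog_mx r s (dr : 'I_r -> int) (ds : 'I_s -> int)
  (M : 'M[S]_(r, s)) := forall a b, homog_int (dr a - ds b) (M a b).

Lemma homog_mx_mul r s t dr ds dt (M : 'M_(r, s)) (N : 'M_(s, t)) :
  homog_mx dr ds M -> homog_mx ds dt N -> homog_mx dr dt (M *m N).
Proof.
move=> hM hN a b; rewrite mxE; apply: homog_int_sum => c _.
by rewrite -(subrKA (ds c)); apply: homog_intM.
Qed.

(** From any lifts of the rows, keep in entry [(a, b)] only the component of degree [dt a - dr b];
    as [M] and [U] are homogeneous, the product is still [U]. *)
Lemma homog_mx_lift r s t dr ds dt (M : 'M_(r, s)) (U : 'M_(t, s)) :
  homog_mx dr ds M -> homog_mx dt ds U ->
  (forall a, exists v, row a U = v *m M) ->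
  exists2 V, homog_mx dt dr V & U = V *m M.
Proof.
move=> hM hU /fin_all_exists[v vP].
exists (\matrix_(a, b) homog_part (dt a - dr b) (v a 0 b)) => [a b|].
  by rewrite mxE; apply: homog_part_homog.
apply/matrixP => a b; have /rowP/(_ b) := vP a; rewrite !mxE => Uab.
have := homog_part_dE (dt a - ds b) (hU a b); rewrite eqxx => <-.
rewrite Uab linear_sum /=; apply: eq_bigr => c _; rewrite mxE.
rewrite (homog_partM _ _ (hM c b)); congr (homog_part _ _ * _); ring.
Qed.

End Homogeneous.

(** * Comparison of graded resolutions: chain maps and homotopies *)

Section Comparison.

Variables (k : fieldType) (n : nat).
Local Notation S := {mpoly k[n]}.

(* The resolution [F] prolonged by its target [S], placed in position 0, so
   that position [i.+1] holds the [i]-th free module of [F]. *)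
Definition aug_rank (I : subset_of_ring k n) (F : graded_resolution I) i :=
  if i is j.+1 then gr_rank F j else 1%N.

Definition aug_diff (I : subset_of_ring k n) (F : graded_resolution I) i :
    'M[S]_(aug_rank F i.+1, aug_rank F i) :=
  if i is j.+1 then gr_diff F j else gr_aug F.

Definition aug_deg (I : subset_of_ring k n) (F : graded_resolution I) i :
    'I_(aug_rank F i) -> int :=
  if i is j.+1 return 'I_(aug_rank F i) -> int then @gr_deg _ _ _ F j
  else fun=> 0.

Lemma aug_diff_homog (I : subset_of_ring k n) (F : graded_resolution I) i :
  homog_mx (@aug_deg _ F i.+1) (@aug_deg _ F i) (aug_diff F i).
Proof.
case: i => [|i] a b /=; last exact: gr_diff_homog.
by rewrite subr0 ord1; apply: gr_aug_homog.
Qed.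

Lemma aug_exact (I : subset_of_ring k n) (F : graded_resolution I) i
    (u : 'rV_(aug_rank F i.+1)) :
  u *m aug_diff F i = 0 <-> exists v, u = v *m aug_diff F i.+1.
Proof. by case: i u => [|i] u; [exact: gr_exact0 | exact: gr_exactS]. Qed.

Lemma aug_diffK (I : subset_of_ring k n) (F : graded_resolution I) i :
  aug_diff F i.+1 *m aug_diff F i = 0.
Proof.
apply/row_matrixP => a; rewrite row0 row_mul.
by apply/aug_exact; exists (delta_mx 0 a); rewrite -rowE.
Qed.

Lemma aug_exact_mx (I : subset_of_ring k n) (F : graded_resolution I) i t
    (U : 'M_(t, aug_rank F i.+1)) :
  U *m aug_diff F i = 0 -> exists V, U = V *m aug_diff F i.+1.
Proof.
move=> U0.
have /fin_all_exists[v vP] a : exists v, row a U = v *m aug_diff F i.+1.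
  by apply/aug_exact; rewrite -row_mul U0 row0.
exists (\matrix_a v a); apply/row_matrixP => a.
by rewrite row_mul rowK vP.
Qed.

(** Comparison theorem: start from the identity of [S] in position 0 and lift
    [aug_diff F i *m phi i] through the differentials of [L], using exactness. *)
Lemma chain_lift (I J : subset_of_ring k n)
    (F : graded_resolution I) (L : graded_resolution J) :
  (forall f, I f -> J f) ->
  exists phi : forall i, 'M_(aug_rank F i, aug_rank L i),
    [/\ phi 0 = 1%:M,
        forall i, homog_mx (@aug_deg _ F i) (@aug_deg _ L i) (phi i)
      & forall i, phi i.+1 *m aug_diff L i = aug_diff F i *m phi i].
Proof.
move=> IJ.
(* The second half of the invariant is what the next lift requires; in position 0 it is the
   inclusion of [I] in [J]. *)
pose Q i (phi : 'M_(aug_rank F i, aug_rank L i)) :=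
  homog_mx (@aug_deg _ F i) (@aug_deg _ L i) phi /\
  forall u : 'rV_(_), exists v, u *m (aug_diff F i *m phi) = v *m aug_diff L i.
pose R i (phi : 'M_(aug_rank F i, aug_rank L i))
         (psi : 'M_(aug_rank F i.+1, aug_rank L i.+1)) :=
  psi *m aug_diff L i = aug_diff F i *m phi.
have [||phi [phi0 phiQ phiR]] :=
    @dependent_choice_nat (fun i => 'M_(aug_rank F i, aug_rank L i))
      Q R 1%:M.
- split=> [a b|u]; first by rewrite mxE; apply/rpredMn/dhomog1.
  have /(gr_aug_image F)/IJ/(gr_aug_image L)[v vP] :
      exists u' : 'rV_(gr_rank F 0),
        (u *m gr_aug F) 0 0 = (u' *m gr_aug F) 0 0.
    by exists u.
  by exists v; rewrite mulmx1; apply/rowP => b; rewrite !ord1.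
- move=> i phi [phih phiQ].
  have [|psi psih psiE] := homog_mx_lift (@aug_diff_homog _ L i)
      (homog_mx_mul (@aug_diff_homog _ F i) phih).
    by move=> a; have [v vP] := phiQ (delta_mx 0 a); exists v; rewrite rowE.
  exists psi; split; [split=> // u | exact: esym].
  apply/aug_exact; rewrite -!mulmxA -psiE (mulmxA (aug_diff F i.+1)).
  by rewrite aug_diffK mul0mx mulmx0.
by exists phi; split=> // i; have [] := phiQ i.
Qed.

(** As [gam] is the identity in position 0, the homotopy can start at 0. Each further matrix exists
    because [1%:M - gam i.+1 - aug_diff F i *m h i] is killed by [aug_diff F i], so exactness
    factors it through the next differential. *)
Lemma chain_homotopy (I : subset_of_ring k n) (F : graded_resolution I)
    (gam : forall i, 'M_(aug_rank F i)) :
  gam 0 = 1%:M ->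
  (forall i, gam i.+1 *m aug_diff F i = aug_diff F i *m gam i) ->
  exists h : forall i, 'M_(aug_rank F i, aug_rank F i.+1),
    h 0 = 0 /\
    forall i, 1%:M - gam i.+1 =
      aug_diff F i *m h i + h i.+1 *m aug_diff F i.+1.
Proof.
move=> gam0 gamD.
pose Q i (h : 'M_(aug_rank F i, aug_rank F i.+1)) :=
  aug_diff F i *m (1%:M - gam i - h *m aug_diff F i) = 0.
pose R i (h : 'M_(aug_rank F i, aug_rank F i.+1))
         (h' : 'M_(aug_rank F i.+1, aug_rank F i.+2)) :=
  1%:M - gam i.+1 = aug_diff F i *m h + h' *m aug_diff F i.+1.
have [||h [h0 _ hR]] := @dependent_choice_nat
    (fun i => 'M_(aug_rank F i, aug_rank F i.+1)) Q R 0.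
- by rewrite /Q gam0 subrr mul0mx subrr mulmx0.
- move=> i h hQ.
  have [|h' hE] := @aug_exact_mx _ F i _
      (1%:M - gam i.+1 - aug_diff F i *m h).
    rewrite !mulmxBl gamD mul1mx -mulmxA -[X in X - _ - _]mulmx1.
    by rewrite -!mulmxBr.
  exists h'; split; last by rewrite /R -hE [RHS]addrC subrK.
  by rewrite /Q -hE subKr mulmxA aug_diffK mul0mx.
by exists h.
Qed.

End Comparison.

(** * Vanishing of Tor in the presence of a linear resolution *)

Lemma submx_diffmx_eq0 (F : fieldType) m1 m2 n
    (A : 'M[F]_(m1, n)) (B : 'M_(m2, n)) :
  (A <= B)%MS -> (A :\: B)%MS = 0.
Proof.
move=> AB; apply/eqP; rewrite -submx0 -(capmx_diff A B) sub_capmx submx_refl.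
exact: submx_trans (diffmxSl _ _) AB.
Qed.

Section Linear.

Variables (k : fieldType) (n : nat).
Local Notation S := {mpoly k[n]}.

Definition linear_res q (I : subset_of_ring k n) (F : graded_resolution I) :=
  forall i (a : 'I_(gr_rank F i)), gr_deg a = (q + i)%:Z.

Lemma Tor_eq0 (I : subset_of_ring k n) q (L F : graded_resolution I) i j :
  linear_res q L -> j != q%:Z -> Tor F i (i%:Z + j) = 0.
Proof.
move=> Llin jq; apply: submx_diffmx_eq0; rewrite sub_capmx capmxSr andbT.
have [phi [phi0 phih phiD]] := chain_lift F L (fun _ => id).
have [psi [psi0 _ psiD]] := chain_lift L F (fun _ => id).
have [||h [h0 hE]] := @chain_homotopy _ _ _ F (fun i => phi i *m psi i).
- by rewrite phi0 psi0 mulmx1.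
- by move=> l; rewrite -mulmxA psiD !mulmxA phiD.
apply/rV_subP => v; rewrite sub_capmx => /andP[vcyc vdeg].
(* [v] is supported on basis vectors of degree [i + j], while those of [L] have degree [q + i];
   entries of [phi i.+1] between them have nonzero degree, hence no constant term. *)
have v_phi : v *m map_mx (mcoeff 0%MM) (phi i.+1) = 0.
  apply/rowP => b; rewrite !mxE big1 // => a _; rewrite mxE.
  have [degE|degNE] := eqVneq (@gr_deg _ _ _ F i a) (i%:Z + j).
    rewrite (homog_int_mcoeff0 (phih i.+1 a b)) ?mulr0 //= degE Llin.
    by apply: contra jq => /eqP; lia.
  have /submxP[w ->] := vdeg.
  by rewrite mul_mx_diag !mxE (negPf degNE) mulr0 mul0r.
(* For [i = 0] the homotopy matrix is 0; otherwise [v] is a cycle. *)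
have v_cyc : v *m map_mx (mcoeff 0%MM) (aug_diff F i *m h i) = 0.
  case: i {jq v_phi vdeg} v vcyc => [|i] v vcyc.
    by rewrite h0 mulmx0 map_mx0 mulmx0.
  by rewrite map_mxM mulmxA (sub_kermxP vcyc) mul0mx.
(* Modulo the variables, the homotopy identity now writes [v] as a boundary. *)
have := congr1 (fun M => v *m map_mx (mcoeff 0%MM) M) (hE i) => /=.
rewrite map_mxB map_mxD mulmxBr mulmxDr v_cyc add0r !map_mxM !mulmxA v_phi.
rewrite map_mx1 mulmx1 mul0mx subr0 => ->.
exact: submxMl.
Qed.

(** * The mapping cone *)

Section Cone.

Variables (q : nat) (I1 I2 I : subset_of_ring k n).
Variables (F1 : graded_resolution I1) (F2 : graded_resolution I2).
Variable G : graded_resolution (ideal_cap I1 I2).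
Hypotheses (lin1 : linear_res q F1) (lin2 : linear_res q F2).
Hypothesis linG : linear_res q.+1 G.
Hypothesis I_add : same_set I (ideal_add I1 I2).

(* [G] with its [i]-th free module in position [i.+1] and 0 in position 0. *)
Definition shift_rank i := if i is j.+1 then gr_rank G j else 0%N.

Definition shift_diff i : 'M[S]_(shift_rank i.+1, shift_rank i) :=
  if i is j.+1 then gr_diff G j else 0.

Lemma shift_diffK i : shift_diff i.+1 *m shift_diff i = 0.
Proof.
case: i => [|i]; first by rewrite [shift_diff 0]/= mulmx0.
exact: (@aug_diffK _ _ _ G i.+1).
Qed.

Variables (phi1 : forall i, 'M[S]_(shift_rank i.+1, gr_rank F1 i))
          (phi2 : forall i, 'M[S]_(shift_rank i.+1, gr_rank F2 i)).
Hypotheses (aug1 : phi1 0 *m gr_aug F1 = gr_aug G)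
           (aug2 : phi2 0 *m gr_aug F2 = gr_aug G).
Hypothesis phi1D :
  forall i, phi1 i.+1 *m gr_diff F1 i = shift_diff i.+1 *m phi1 i.
Hypothesis phi2D :
  forall i, phi2 i.+1 *m gr_diff F2 i = shift_diff i.+1 *m phi2 i.
Hypotheses (phi1h : forall i a b, homog_int 1 (phi1 i a b))
           (phi2h : forall i a b, homog_int 1 (phi2 i a b)).

Definition cone_rank i := (shift_rank i + (gr_rank F1 i + gr_rank F2 i))%N.

Definition cone_aug : 'cV[S]_(cone_rank 0) :=
  col_mx 0 (col_mx (gr_aug F1) (gr_aug F2)).

(** Sends [(g, f1, f2)] to [(- d g, phi1 g + d f1, d f2 - phi2 g)]; the sign on [d g] makes
    consecutive maps compose to 0. *)
Definition cone_diff i : 'M[S]_(cone_rank i.+1, cone_rank i) :=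
  block_mx (- shift_diff i) (row_mx (phi1 i) (- phi2 i))
           0 (block_mx (gr_diff F1 i) 0 0 (gr_diff F2 i)).

Lemma mul_cone_aug t (g : 'M_(t, _)) f1 f2 :
  row_mx g (row_mx f1 f2) *m cone_aug = f1 *m gr_aug F1 + f2 *m gr_aug F2.
Proof. by rewrite !mul_row_col mulmx0 add0r. Qed.

Lemma mul_cone_diff t i (g : 'M_(t, _)) f1 f2 :
  row_mx g (row_mx f1 f2) *m cone_diff i =
  row_mx (- (g *m shift_diff i))
    (row_mx (g *m phi1 i + f1 *m gr_diff F1 i)
            (f2 *m gr_diff F2 i - g *m phi2 i)).
Proof.
rewrite mul_row_block mulmx0 addr0 mulmxN mul_mx_row mul_row_block.
by rewrite !mulmx0 addr0 add0r add_row_mx mulmxN [- _ + _]addrC.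
Qed.

Lemma cone_aug_image f :
  I f <-> exists u : 'rV_(cone_rank 0), f = (u *m cone_aug) 0 0.
Proof.
split=> [/I_add[f1 [f2 [/gr_aug_image - /(_ F1)[u1 ->]]]]|[u ->]].
  move=> /gr_aug_image - /(_ F2)[u2 ->] ->.
  by exists (row_mx 0 (row_mx u1 u2)); rewrite mul_cone_aug [RHS]mxE.
rewrite -[u]hsubmxK -[rsubmx u]hsubmxK mul_cone_aug mxE; apply/I_add.
do 2 eexists; split; last by [].
  by apply/(gr_aug_image F1); eexists.
by apply/(gr_aug_image F2); eexists.
Qed.

(** In a kernel element, [f1] and [f2] have opposite images, which therefore lie in both ideals and
    come from some [g] in [G]; correcting by [phi1 g] and [phi2 g] leaves kernel elements of the two
    augmentations. *)
Lemma cone_exact0 (u : 'rV_(cone_rank 0)) :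
  u *m cone_aug = 0 <-> exists v : 'rV_(cone_rank 1), u = v *m cone_diff 0.
Proof.
split=> [|[v ->]]; last first.
  rewrite -[v]hsubmxK -[rsubmx v]hsubmxK mul_cone_diff mul_cone_aug.
  rewrite mulmxBl mulmxDl -!mulmxA aug1 aug2.
  rewrite (@aug_diffK _ _ _ F1 0) (@aug_diffK _ _ _ F2 0).
  by rewrite !mulmx0 addr0 sub0r subrr.
rewrite -[u]hsubmxK -[rsubmx u]hsubmxK mul_cone_aug.
set f1 := lsubmx _; set f2 := rsubmx _; rewrite (thinmx0 (lsubmx u)) => uaug.
have f2E : f2 *m gr_aug F2 = - (f1 *m gr_aug F1).
  by apply/eqP; rewrite -addr_eq0 addrC uaug.
have [g gE] : exists g : 'rV_(gr_rank G 0),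
    (f1 *m gr_aug F1) 0 0 = (g *m gr_aug G) 0 0.
  apply/(gr_aug_image G); split; first by apply/(gr_aug_image F1); exists f1.
  apply/(gr_aug_image F2); exists (- f2).
  by rewrite mulNmx f2E opprK.
have {}gE : f1 *m gr_aug F1 = g *m gr_aug G by apply/rowP => b; rewrite !ord1.
have /gr_exact0[v1 v1E] : (f1 - g *m phi1 0) *m gr_aug F1 = 0.
  by rewrite mulmxBl -mulmxA aug1 gE subrr.
have /gr_exact0[v2 v2E] : (f2 + g *m phi2 0) *m gr_aug F2 = 0.
  by rewrite mulmxDl -mulmxA aug2 f2E gE addNr.
exists (row_mx g (row_mx v1 v2)); rewrite mul_cone_diff -v1E -v2E.
by rewrite addrC subrK addrK; congr row_mx; apply/esym/thinmx0.
Qed.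

(** The component [g] is a boundary of some [g'] in [G]; correcting [f1] and [f2] by the images of
    [g'] leaves cycles of [F1] and [F2]. *)
Lemma cone_exactS i (u : 'rV_(cone_rank i.+1)) :
  u *m cone_diff i = 0 <->
  exists v : 'rV_(cone_rank i.+2), u = v *m cone_diff i.+1.
Proof.
split=> [|[v ->]]; last first.
  rewrite -[v]hsubmxK -[rsubmx v]hsubmxK !mul_cone_diff.
  rewrite mulNmx -mulmxA shift_diffK mulmx0 !oppr0.
  rewrite !mulmxBl !mulmxDl -!mulmxA phi1D phi2D !mulNmx -!mulmxA.
  rewrite (@aug_diffK _ _ _ F1 i.+1) (@aug_diffK _ _ _ F2 i.+1) !mulmx0 addr0.
  by rewrite addNr sub0r opprK addNr !row_mx0.
rewrite -[u]hsubmxK -[rsubmx u]hsubmxK.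
move: (lsubmx u) (lsubmx (rsubmx u)) (rsubmx (rsubmx u)) => g f1 f2.
rewrite mul_cone_diff => /eqP; rewrite !row_mx_eq0 oppr_eq0.
case/and3P=> /eqP gD /eqP f1E /eqP f2E.
have [g' gE] : exists g' : 'rV_(shift_rank i.+2), g = g' *m shift_diff i.+1.
  apply/(@aug_exact _ _ _ G i).
  (* [shift_diff 0] is 0 and says nothing on [g]; for [i = 0] the [F1] component, pushed to [S],
     shows that [gr_aug G] kills [g]. *)
  case: i g f1 f2 gD f1E f2E {u} => [|i] g f1 f2 gD f1E f2E //.
  have := congr1 (mulmx^~ (gr_aug F1)) f1E.
  rewrite mulmxDl -!mulmxA aug1 (@aug_diffK _ _ _ F1 0).
  by rewrite mulmx0 addr0 mul0mx.
have /gr_exactS[v1 v1E] : (f1 + g' *m phi1 i.+1) *m gr_diff F1 i = 0.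
  by rewrite mulmxDl -mulmxA phi1D mulmxA -gE addrC.
have /gr_exactS[v2 v2E] : (f2 - g' *m phi2 i.+1) *m gr_diff F2 i = 0.
  by rewrite mulmxBl -mulmxA phi2D mulmxA -gE.
exists (row_mx (- g') (row_mx v1 v2)); rewrite mul_cone_diff -v1E -v2E.
by rewrite !mulNmx -gE !opprK addrC addrK subrK.
Qed.

Lemma gr_diff_linear r (J : subset_of_ring k n) (F : graded_resolution J)
    i a b :
  linear_res r F -> homog_int 1 (gr_diff F i a b).
Proof.
move=> Flin; have := gr_diff_homog a b; rewrite !Flin.
by congr homog_int; lia.
Qed.

Lemma cone_aug_homog a : homog_int q%:Z (cone_aug a 0).
Proof.
rewrite /cone_aug -[a]splitK; case: (split a) => [[]//|{}a].
rewrite [unsplit _]/= col_mxEd -[a]splitK.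
case: (split a) => {}a; rewrite [unsplit _]/= ?col_mxEu ?col_mxEd.
  by have := gr_aug_homog a; rewrite lin1 addn0.
by have := gr_aug_homog a; rewrite lin2 addn0.
Qed.

Lemma cone_diff_homog i a b : homog_int 1 (cone_diff i a b).
Proof.
have sh a' b' : homog_int 1 (- shift_diff i a' b').
  case: i {a b} a' b' => [|i] a' b'; first by case: b'.
  by rewrite homog_intN; apply: gr_diff_linear linG.
rewrite /cone_diff mxE.
case: (split a) => {}a; rewrite !mxE; case: (split b) => {}b; rewrite ?mxE.
- exact: sh.
- by case: (split b) => {}b; rewrite ?mxE ?homog_intN.
- exact: homog_int0.
- case: (split a) => {}a; rewrite !mxE; case: (split b) => {}b;
    rewrite ?mxE ?homog_int0 //.
  + exact: gr_diff_linear lin1.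
  + exact: gr_diff_linear lin2.
Qed.

(** Generators of [G] of degree [q.+1 + i] sit in position [i.+1], which gives the uniform degree
    [q + i]. The definition is transparent so that these degrees are read off by computation. *)
Definition cone : graded_resolution I.
Proof.
apply: (@GradedResolution k n I cone_rank (fun i _ => (q + i)%:Z)
  cone_aug cone_diff) => [a|i a b|f|u|i u].
- by rewrite addn0; apply: cone_aug_homog.
- have -> : (q + i.+1)%:Z - (q + i)%:Z = 1 by lia.
  exact: cone_diff_homog.
- exact: cone_aug_image.
- exact: cone_exact0.
- exact: cone_exactS.
Defined.

End Cone.

(** * Linear resolutions of constructible ideals, by induction *)

Lemma exists_linear_res q (I : subset_of_ring k n) :
  constructible q I -> exists F : graded_resolution I, linear_res q F.
Proof.
elim=> {q I} [m I Im|q I1 I2 I _ [F1 lin1] _ [F2 lin2] _ [G linG] I_add].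
  (* Principal case: multiplication by the monomial is injective with image [I], so one copy of [S]
     in position 0 resolves [I]. *)
  have IE f : I f <-> exists u : 'rV[S]_1, f = (u *m 'X_[m]%:M) 0 0.
    split=> [/Im[g ->]|[u ->]].
      by exists g%:M; rewrite -scalar_mxM mxE mulr1n.
    by apply/Im; exists (u 0 0); rewrite mul_mx_scalar mxE mulrC.
  pose rk i : nat := i == 0%N.
  have ex0 (u : 'rV[S]_1) : u *m 'X_[m]%:M = 0 <->
      exists v : 'rV_0, u = v *m (0 : 'M_(0, 1)).
    rewrite mul_mx_scalar.
    split=> [/rowP u0|[v ->]]; last by rewrite mulmx0 scaler0.
    exists 0; apply/rowP => a; rewrite mulmx0 mxE.
    have /eqP := u0 a; rewrite !mxE mulf_eq0 => /orP[/eqP Xm|/eqP //].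
    by have := mcoeffX k m m; rewrite Xm mcoeff0 eqxx => /esym/eqP;
      rewrite oner_eq0.
  unshelve eexists.
    apply: (@GradedResolution k n I rk (fun i _ => (mdeg m + i)%:Z)
      ('X_[m]%:M : 'M_1) (fun i => 0)) => [a|i []//|//|//|i u].
      by rewrite addn0 !ord1 mxE eqxx /= dhomogX.
    split=> _; last by rewrite mulmx0.
    by exists 0; rewrite mulmx0; apply/rowP => -[].
  by [].
(* Sum case: lift both inclusions of the intersection. Position [i.+1] of an augmented resolution is
   its [i]-th module, whence the index shift below. *)
have [phi1 [phi10 phi1h phi1D]] := chain_lift G F1 (fun _ => @proj1 _ _).
have [phi2 [phi20 phi2h phi2D]] := chain_lift G F2 (fun _ => @proj2 _ _).
unshelve eexists.
  apply: (@cone q I1 I2 I F1 F2 G lin1 lin2 linG I_add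
           (fun i => phi1 i.+1) (fun i => phi2 i.+1)).
  - by rewrite [LHS](phi1D 0) phi10 mulmx1.
  - by rewrite [LHS](phi2D 0) phi20 mulmx1.
  - by move=> i; exact: (phi1D i.+1).
  - by move=> i; exact: (phi2D i.+1).
  - move=> i a b; have -> : 1 = @gr_deg _ _ _ G i a - @gr_deg _ _ _ F1 i b.
      by rewrite linG lin1; lia.
    exact: phi1h i.+1 a b.
  - move=> i a b; have -> : 1 = @gr_deg _ _ _ G i a - @gr_deg _ _ _ F2 i b.
      by rewrite linG lin2; lia.
    exact: phi2h i.+1 a b.
by [].
Qed.

End Linear.

Theorem theorem3p2p3 (k : fieldType) (n q : nat) (I : subset_of_ring k n)
    (hI : constructible q I) : has_linear_resolution q I.
Proof.
have [L Llin] := exists_linear_res hI.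
by split=> [|F i j jq]; [exists | apply: Tor_eq0 Llin jq].
Qed.
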